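(* Let $m<0<M$ be real numbers and let $\varphi$ be a positive monotone increasing function on $\left[0,\frac{-mM}{M-m}\right]$. For every $f\in\mathcal{F}_{m,M}$ we have $$\int_0^1\varphi\big(|J(f)(x)|\big)\,dx\leq K\left(\varphi,\frac{-mM}{M-m}\right).$$ Moreover, if $\varphi$ is not constant on $\left(0,\frac{-mM}{M-m}\right)$, then equality holds if and only if $f$ coincides for almost every $x$ in $[0,1]$ with one of the functions $f_0$ or $f_1$ defined by $$f_0(x)=\begin{cases}M&\text{if }x\in\left[0,\frac{-m}{M-m}\right),\\ m&\text{if }x\in\left[\frac{-m}{M-m},1\right],\end{cases}\qquad f_1(x)=\begin{cases}m&\text{if }x\in\left[0,\frac{M}{M-m}\right),\\ M&\text{if }x\in\left[\frac{M}{M-m},1\right].\end{cases}$$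
   Context: For real numbers $m<0<M$, $\mathcal{F}_{m,M}$ denotes the set of functions $f\in L^\infty([0,1])$ (essentially bounded measurable real functions on $[0,1]$) such that $m\leq f\leq M$ and $\int_0^1 f(x)\,dx=0$. For $f\in L^\infty([0,1])$, the continuous function $J(f):[0,1]\to\mathbb{R}$ is defined by $J(f)(x)=\int_0^x f(t)\,dt$. For a monotone increasing function $\varphi:[0,T]\to\mathbb{R}$ and $t\in(0,T]$, $K(\varphi,t)=\frac{1}{t}\int_0^t\varphi(x)\,dx$.
   Formalization: The ''only if'' of the equality case is proved when φ is not constant on (a,T) for any 0≤a<T, T=-mM/(M-m), instead of only not constant on (0,T): if φ is constant on some (a,T), truncating the primitive of f_0 at a height in (a,T) gives another case of equality. *)

(* Defs.v *)
From HB Require Import structures.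
From mathcomp Require Import all_boot all_order all_algebra.
From mathcomp Require Import all_classical all_reals all_analysis.

Set Implicit Arguments.
Unset Strict Implicit.
Unset Printing Implicit Defensive.

Import Order.TTheory GRing.Theory Num.Theory.
Import numFieldNormedType.Exports.

Local Open Scope classical_set_scope.
Local Open Scope ring_scope.

Section Defs.
Variable R : realType.
Implicit Types (f g phi : R -> R) (m M a b t x : R).

Notation mu := (@lebesgue_measure R).

(* Elements of L^oo([0, 1]) are given by representatives R -> R; only their
   restriction to [0, 1] matters. *)
Definition Linfty01 f : Prop :=
  measurable_fun (`[0, 1] : set R) f /\
  exists C : R, {ae mu, forall x, x \in `[0, 1] -> `|f x| <= C}.

Definition ae_eq01 f g : Prop := {ae mu, forall x, x \in `[0, 1] -> f x = g x}.

Definition FmM m M f : Prop :=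
  [/\ Linfty01 f,
      {ae mu, forall x, x \in `[0, 1] -> m <= f x <= M} &
      \int[mu]_(x in `[0, 1]) f x = 0].

Definition J f x : R := \int[mu]_(t in `[0, x]) f t.

Definition K phi t : R := t^-1 * \int[mu]_(x in `[0, t]) phi x.

Definition Tmax m M : R := (- m * M) / (M - m).

Definition f0 m M x : R := if x < - m / (M - m) then M else m.

Definition f1 m M x : R := if x < M / (M - m) then m else M.

Definition nondecreasing_on a b phi : Prop :=
  {in `[a, b] &, {homo phi : x y / x <= y}}.

Definition constant_on a b phi : Prop :=
  exists c : R, {in `]a, b[, forall x, phi x = c}.

(* For a nondecreasing phi this is strictly stronger than nonconstancy on
   ]0, b[, and every phi strictly increasing on ]0, b[ satisfies it.
   If phi is constant on ]a, b[ with b = Tmax m M, any f whose primitive follows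
   that of [f0 m M] up to height in ]a, b[, stays there and then comes back down
   gives the same integral as [f0 m M]; so nonconstancy on ]0, b[ alone does not
   force f to be [f0 m M] or [f1 m M].  E.g. m = -1, M = 1, b = 1/2, phi = 1 on
   [0, 1/4] and 2 on ]1/4, 1/2], f = 1, 0, -1 on [0, 3/8], ]3/8, 5/8], ]5/8, 1]:
   both sides are 3/2. *)
Definition nonconstant_up_to b phi : Prop :=
  forall a, 0 <= a < b -> ~ constant_on a b phi.

End Defs.

(* Main.v *)
Require Import Defs.
From mathcomp Require Import all_boot all_order all_algebra.
From mathcomp Require Import all_classical all_reals all_analysis.
From mathcomp Require Import measurable_realfun lra ring.

(** Put [F := J f] and [b := Tmax m M], so that [1 / b = 1 / M - 1 / m]. The
    slopes of [F] lie in [[m, M]] and [F] vanishes at [0] and [1].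

    If [`|F|] reaches a height [t] somewhere, say [F x0 >= t], then [F] must climb
    from [0] to [t] before [x0], which takes time at least [t / M], and come back
    to [0] after [x0], which takes time at least [- t / m]. During these two
    stretches [`|F| < t], so the set where [`|F| >= t] has measure at most
    [1 - t / b] ([measure_level_set_le]). This says that [`|F|], under Lebesgue
    measure on [[0, 1]], is stochastically dominated by the uniform distribution
    on [[0, b]]; the layer cake formula turns the domination into an inequality
    between the integrals of any nonnegative nondecreasing function
    ([le_integral_nondecreasing]). This is the inequality.

    For [f0] the primitive is a tent whose level sets have measure exactly
    [1 - t / b], so that the same comparison applies in both directions. Up
    to sign, [f1] is the function [f0] of the pair [(- M, - m)], which has the same
    [b].

    Conversely, suppose that equality holds and let [c] be the maximum of [`|F|].
    Replacing [phi y] by [phi (min c y)] does not change the left-hand side, but if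
    [c < b] it strictly decreases the right-hand side, because [phi] is not
    constant between [c] and [b] ([K_minr_lt]); the inequality for the truncated function
    then contradicts equality. So [c = b]. A function with slopes in [[m, M]]
    vanishing at [0] and [1] can reach the height [b] only by climbing at slope [M]
    and descending at slope [m] throughout, and this determines [f] almost
    everywhere ([ae_eq_f0_of_peak]). *)

Import Order.TTheory GRing.Theory Num.Theory.
Import numFieldNormedType.Exports.

Set Implicit Arguments.
Unset Strict Implicit.
Unset Printing Implicit Defensive.

Local Open Scope classical_set_scope.
Local Open Scope ring_scope.

(** * Functions with slopes in [[m, M]] and their level sets *)

(** The level set estimates hold for every such function vanishing at [0] and
    [1]. This class is stable under the reflections
    [F -> - F] and [x -> 1 - x], which replace [(m, M)] by [(- M, - m)]. *)
Definition slopes_within (R : realType) (m M : R) (F : R -> R) : Prop :=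
  forall x y : R, 0 <= x -> x <= y -> y <= 1 ->
    m * (y - x) <= F y - F x <= M * (y - x).

Lemma slopes_withinN (R : realType) (m M : R) (F : R -> R) :
  slopes_within m M F -> slopes_within (- M) (- m) (fun x => - F x).
Proof.
move=> sF x y x0 xy y1; have /andP[? ?] := sF x y x0 xy y1.
by apply/andP; split; lra.
Qed.

Lemma Tmax_gt0 (R : realType) (m M : R) : m < 0 -> 0 < M -> 0 < Tmax m M.
Proof. by move=> m0 M0; rewrite /Tmax divr_gt0 ?mulr_gt0 ?oppr_gt0//; lra. Qed.

Lemma TmaxN (R : realType) (m M : R) : Tmax (- M) (- m) = Tmax m M.
Proof. by rewrite /Tmax; congr (_ / _); ring. Qed.

(** A rise from [0] to [t] at slope [M] followed by a descent to [0] at slope [m]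
    takes time [t / M - t / m]; this is [t / Tmax m M]. *)
Lemma Tmax_inv (R : realType) (m M : R) : m < 0 -> 0 < M ->
  (Tmax m M)^-1 = M^-1 - m^-1.
Proof.
move=> m0 M0; rewrite /Tmax; field.
by rewrite lt_eqF// gt_eqF// gt_eqF//; lra.
Qed.

(** Take for [p] the supremum of the points before [x0] where [F <= 0]: beyond
    [p], [F] is positive, and as it climbs from [F p <= 0] at rate at most [L] it
    needs time [t / L] to reach the height [t]. *)
Lemma strip_before_level (R : realType) (L t x0 : R) (F : R -> R) :
    0 < L -> 0 < t ->
    (forall x y : R, 0 <= x -> x <= y -> y <= 1 -> F y - F x <= L * (y - x)) ->
    F 0 = 0 -> 0 <= x0 <= 1 -> t <= F x0 ->
  exists p, [/\ 0 <= p, p + t / L <= x0 &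
    forall x, p < x < p + t / L -> 0 < F x < t].
Proof.
move=> L0 t0 sF F0 /andP[x00 x01] tF.
pose E := [set x | 0 <= x <= x0 /\ F x <= 0].
have E0 : E 0 by rewrite /E/= F0 lexx.
have supE : has_sup E by split; [exists 0 | exists x0 => y [/andP[]]].
have p0 : 0 <= sup E by exact: (sup_upper_bound supE).
have px0 : sup E <= x0 by apply: sup_le_ub => [|y [/andP[]]//]; exists 0.
(* since [F] grows at rate at most [L], points of [E] close to [sup E] force
   [F (sup E) <= 0] *)
have Fp : F (sup E) <= 0.
  rewrite leNgt; apply/negP => Fp0.
  have e0 : 0 < F (sup E) / L by rewrite divr_gt0.
  have [y [/andP[y0 yx0] Fy]] := sup_adherent e0 supE.
  rewrite ltrBlDl -ltrBlDr ltr_pdivlMr// => ypy.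
  have ysup : y <= sup E.
    by apply: (sup_upper_bound supE) => //; rewrite /E/= y0.
  by have := sF y (sup E) y0 ysup ltac:(lra); lra.
have strip x : sup E < x -> x <= x0 -> 0 < F x.
  move=> px xx0; rewrite ltNge; apply/negP => Fx.
  suff : x <= sup E by lra.
  by apply: (sup_upper_bound supE) => //; split => //; lra.
have le0 : sup E + t / L <= x0.
  rewrite -lerBrDl ler_pdivrMr//.
  by have := sF (sup E) x0 p0 px0 x01; lra.
exists (sup E); split => // x /andP[px xpt].
rewrite strip//=; last lra.
have := sF (sup E) x p0 (ltW px) ltac:(lra).
have : L * (x - sup E) < t by rewrite mulrC -ltr_pdivlMr//; lra.
lra.
Qed.

(** The open gaps of the cover, of lengths [t / M] and [- t / m], are the strips
    on either side of [x0] in which [0 < F < t]. *)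
Lemma level_set_cover (R : realType) (m M t x0 : R) (F : R -> R) :
    m < 0 -> 0 < M -> 0 < t -> slopes_within m M F -> F 0 = 0 -> F 1 = 0 ->
    0 <= x0 <= 1 -> t <= F x0 ->
  exists p q, [/\ 0 <= p, p + t / M <= q + t / m, q <= 1 &
    `[0, 1] `&` [set x | t <= `|F x|] `<=`
      `[0, p] `|` `[p + t / M, q + t / m] `|` `[q, 1]].
Proof.
move=> m0 M0 t0 sF F0 F1 /andP[x00 x01] tF.
have [x y a c d||p [p0 px0 hp]] := strip_before_level M0 t0 _ F0 _ tF.
- by case/andP: (sF x y a c d).
- by rewrite x00.
(* the strip after [x0] is the strip before [1 - x0] of the reflected function *)
have [|||||q [q0 qx0 hq]] :=
    @strip_before_level R (- m) t (1 - x0) (fun x => F (1 - x)) _ t0.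
- by rewrite oppr_gt0.
- move=> x y a c d.
  have /andP[+ _] := sF (1 - y) (1 - x) ltac:(lra) ltac:(lra) ltac:(lra).
  lra.
- by rewrite subr0.
- lra.
- by rewrite subKr.
have e : t / - m = - (t / m) by rewrite invrN mulrN.
rewrite e in qx0 hq.
exists p, (1 - q); split; [done|lra|lra|].
move=> x [/=]; rewrite in_itv/= => /andP[xge0 xle1] tFx.
have [xp|px] := leP x p; first by left; left; rewrite /= in_itv/= xge0.
have [qx|xq] := leP (1 - q) x; first by right; rewrite /= in_itv/= qx.
left; right; rewrite /= in_itv/=; apply/andP; split;
  rewrite leNgt; apply/negP => h.
  have /andP[Fx0 Fxt] := hp x ltac:(lra).
  by move: tFx; rewrite gtr0_norm//; lra.
have := hq (1 - x) ltac:(lra); rewrite subKr => /andP[Fx0 Fxt].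
by move: tFx; rewrite gtr0_norm//; lra.
Qed.

Lemma measure_itvcc_le (R : realType) (x y : R) : x <= y ->
  (lebesgue_measure (`[x, y]%classic : set R) <= (y - x)%:E)%E.
Proof.
move=> xy; rewrite lebesgue_measure_itv/= lte_fin.
by case: ltgtP xy => // -> _; rewrite subrr.
Qed.

Lemma measure_itvoo_ge (R : realType) (x y : R) :
  ((y - x)%:E <= lebesgue_measure (`]x, y[%classic : set R))%E.
Proof.
rewrite lebesgue_measure_itv/= lte_fin.
by case: ltP => // yx; rewrite lee_fin subr_le0.
Qed.

Lemma fine_measure_itvoo (R : realType) (x y : R) : x <= y ->
  fine (@lebesgue_measure R `]x, y[) = y - x.
Proof.
move=> xy; rewrite lebesgue_measure_itv/= lte_fin.
by case: ltgtP xy => // -> _; rewrite subrr.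
Qed.

Lemma measure_itv_cover (R : realType) (A : set R) (a c d e f g : R) :
  measurable A -> a <= c -> d <= e -> f <= g ->
  A `<=` `[a, c] `|` `[d, e] `|` `[f, g] ->
  (lebesgue_measure A <= ((c - a) + (e - d) + (g - f))%:E)%E.
Proof.
move=> mA ac de fg /(le_measure (@lebesgue_measure R)) sub.
apply: (le_trans (sub _ _)); rewrite ?inE//.
  by apply: measurableU => //; apply: measurableU.
rewrite (EFinD (c - a + (e - d))) (EFinD (c - a)).
apply: (le_trans (measureU2 _ _ _)) => //; first exact: measurableU.
apply: leeD; last exact: measure_itvcc_le.
apply: (le_trans (measureU2 _ _ _)) => //.
by apply: leeD; exact: measure_itvcc_le.
Qed.

Lemma measurable_level_ge (R : realType) (A : set R) (g : R -> R) (r : R) :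
  measurable A -> measurable_fun A g -> measurable (A `&` [set x | r <= g x]).
Proof.
move=> mA mg; have := mg mA _ (measurable_itv `[r, +oo[).
by congr measurable; apply/seteqP; split => x /=; rewrite !in_itv/= andbT.
Qed.

Lemma measurable_level_gt (R : realType) (A : set R) (g : R -> R) (r : R) :
  measurable A -> measurable_fun A g -> measurable (A `&` [set x | r < g x]).
Proof.
move=> mA mg; have := mg mA _ (measurable_itv `]r, +oo[).
by congr measurable; apply/seteqP; split => x /=; rewrite !in_itv/= andbT.
Qed.

(** The key estimate. The two strips around a point where [`|F|] reaches [t] are
    disjoint and have total length [t / Tmax m M]; if no such point exists the
    level set is empty. *)
Lemma measure_level_set_le (R : realType) (m M t : R) (F : R -> R) :
    m < 0 -> 0 < M -> 0 <= t <= Tmax m M ->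
    measurable_fun (`[0, 1] : set R) F ->
    slopes_within m M F -> F 0 = 0 -> F 1 = 0 ->
  (lebesgue_measure (`[0, 1] `&` [set x | t <= `|F x|])%R
    <= (1 - t / Tmax m M)%:E)%E.
Proof.
move=> m0 M0 /andP[t0 tb] mF sF F0 F1.
have b0 := Tmax_gt0 m0 M0.
set A := _ `&` _.
have mA : measurable A.
  apply: (@measurable_level_ge R `[0, 1] (fun x => `|F x|)) => //.
  exact: measurableT_comp.
have A1 : (lebesgue_measure A <= 1)%E.
  have /(le_measure (@lebesgue_measure R)) sub : A `<=` `[0, 1] by move=> x [].
  apply: (le_trans (sub _ _)); rewrite ?inE//.
  by apply: (le_trans (measure_itvcc_le ler01)); rewrite subr0.
have [t00|t_gt0] := leP t 0.
  have -> : t = 0 by apply/le_anti; rewrite t00.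
  by rewrite mul0r subr0.
have [A0|/eqP/set0P [x0 [/= x01 tFx]]] := pselect (A = set0).
  by rewrite A0 measure0 lee_fin subr_ge0 ler_pdivrMr// mul1r.
have eN k : t / - k = - (t / k) by rewrite invrN mulrN.
suff [p [u [v [q [p0 uv q1 [len sub]]]]]] : exists p u v q,
    [/\ 0 <= p, u <= v, q <= 1 & p + (v - u) + (1 - q) = 1 - t / Tmax m M /\
        A `<=` `[0, p] `|` `[u, v] `|` `[q, 1]].
  apply: (le_trans (measure_itv_cover mA p0 uv q1 sub)).
  by rewrite lee_fin subr0 len.
move: tFx; rewrite ler_normr => /orP[tFx|tFx].
  have [p [q [p0 pq q1 sub]]] := level_set_cover m0 M0 t_gt0 sF F0 F1 x01 tFx.
  exists p, (p + t / M), (q + t / m), q; split => //; split => //.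
  by rewrite Tmax_inv// mulrBr; lra.
have [||||p [q [p0 pq q1 sub]]] := @level_set_cover R (- M) (- m) t x0
  (fun x => - F x) _ _ t_gt0 (slopes_withinN sF) _ _ x01 tFx.
- by rewrite oppr_lt0.
- by rewrite oppr_gt0.
- by rewrite F0 oppr0.
- by rewrite F1 oppr0.
exists p, (p + t / - m), (q + t / - M), q; split => //; split.
  by rewrite Tmax_inv// mulrBr !eN; lra.
by move=> x [x01' tx]; apply: sub; split => //=; rewrite normrN.
Qed.

(** * Layer cake formula and comparison of level sets *)

Lemma measurable_subgraph (R : realType) (A : set R) (g : R -> R) :
  measurable A -> measurable_fun A g ->
  measurable [set z : R * R | A z.1 /\ 0 <= z.2 < g z.1].
Proof.
move=> mA mg.
have mgA : measurable_fun [set: R] (g \_ A).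
  by apply/(measurable_restrictT _ _).1.
have m1 : measurable [set z : R * R | 0 <= z.2].
  have /(_ measurableT [set true]) :
      measurable_fun setT (fun z : R * R => 0 <= z.2).
    exact: measurable_fun_ler.
  by rewrite setTI; exact.
have m2 : measurable [set z : R * R | z.2 < (g \_ A) z.1].
  have /(_ measurableT [set true]) :
      measurable_fun setT (fun z : R * R => z.2 < (g \_ A) z.1).
    by apply: measurable_fun_ltr => //; apply: measurableT_comp.
  by rewrite setTI; exact.
rewrite (_ : [set z | _] =
    [set z : R * R | 0 <= z.2] `&` [set z : R * R | z.2 < (g \_ A) z.1]).
  exact: measurableI.
apply/seteqP; split => -[x s]/=.
  by move=> [Ax /andP[s0 sg]]; rewrite patchE mem_set.
move=> [s0]; rewrite patchE; case: ifPn => [/set_mem Ax sg|_].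
  by split => //; rewrite s0.
by rewrite ltNge s0.
Qed.

(** Layer cake formula: Tonelli's theorem applied to the indicator function of
    the subgraph of [g]. The condition [0 <= s] lets [s] range over the whole
    line. *)
Lemma integral_superlevel (R : realType) (A : set R) (g : R -> R) :
  let mu := @lebesgue_measure R in
  let L := fun s => mu (A `&` [set x | 0 <= s < g x]) in
  measurable A -> measurable_fun A g -> (forall x, A x -> 0 <= g x) ->
  measurable_fun [set: R] L /\
  (\int[mu]_(x in A) (g x)%:E = \int[mu]_s L s)%E.
Proof.
move=> mu L mA mg g0.
pose S := [set z : R * R | A z.1 /\ 0 <= z.2 < g z.1].
have mS : measurable S by exact: measurable_subgraph.
pose f := fun z : R * R => ((\1_S z : R)%:E).
have mf : measurable_fun setT f.
  by apply/measurable_EFinP; exact: measurable_indic.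
have f0 z : (0 <= f z)%E by rewrite lee_fin.
have LE s : L s = (\int[mu]_x f (x, s))%E.
  rewrite /f (_ : (fun x => _) =
    (fun x => (\1_(A `&` [set x | 0 <= s < g x]) x)%:E)) //.
  rewrite integral_indic ?setIT//.
  have := @measurable_ysection _ _ _ _ S s mS.
  rewrite /ysection/=; congr measurable.
  by apply/seteqP; split => x /=; rewrite inE.
split.
  have := @measurable_fun_fubini_tonelli_G _ _ _ _ _ mu f mf f0.
  by congr measurable_fun; apply/funext => s; rewrite LE.
transitivity (\int[mu]_x \int[mu]_s f (x, s))%E.
  rewrite integral_mkcond; apply: eq_integral => x _.
  rewrite patchE; case: ifPn => [/set_mem Ax|nAx].
    rewrite (_ : (fun s => f (x, s)) =
        (fun s => (\1_(`[0, g x[ : set R) s)%:E)).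
      rewrite integral_indic ?setIT//.
      apply/esym; apply: (etrans (lebesgue_measure_itv `[0, g x[)).
      rewrite /= lte_fin oppr0 adde0.
      by have := g0 _ Ax; rewrite le_eqVlt => /predU1P[<-|->//]; rewrite ltxx.
    apply/funext => s; rewrite /f !indicE; congr (_%:R%:E); congr nat_of_bool.
    by apply/idP/idP; rewrite !inE/= in_itv/=; [move=> []|].
  rewrite integral0_eq// => s _; rewrite /f indicE memNset//=.
  by case=> Ax; rewrite mem_set in nAx.
apply: (etrans (@fubini_tonelli _ _ _ _ _ (@lebesgue_measure R)
  (@lebesgue_measure R) f mf f0)).
by apply: eq_integral => s _; rewrite LE.
Qed.

(** A superlevel set of a nondecreasing function is an up-set, hence squeezed
    between the rays [y > t] and [y >= t]. *)
Lemma upper_threshold (R : realType) (b s : R) (phi : R -> R) :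
    0 <= b -> nondecreasing_on 0 b phi ->
  exists2 t, 0 <= t <= b &
    forall y, 0 <= y <= b ->
      (s < phi y -> t <= y) /\ (t < y -> s < phi y).
Proof.
move=> b0 hphi.
(* adding [b] makes the set nonempty, so that the threshold is [b] when [phi]
   stays below [s] *)
pose E := [set y | 0 <= y <= b /\ (s < phi y \/ y = b)].
have Eb : E b by split; [rewrite b0 lexx | right].
have infE : has_inf E by split; [exists b | exists 0 => y [/andP[]]].
exists (inf E).
  apply/andP; split; first by apply: lb_le_inf; [exists b | move=> y [/andP[]]].
  exact: (ge_inf infE.2).
move=> y /andP[y0 yb]; split => [sy|].
  by apply: (ge_inf infE.2); split; [rewrite y0 | left].
move=> /(inf_lt infE.1) [z [/andP[z0 zb] [sz|zbE]] zy].
  by apply: (lt_le_trans sz); apply: hphi; rewrite ?in_itv/= ?z0 ?y0 ?(ltW zy).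
by move: yb; rewrite leNgt -zbE zy.
Qed.

(** Precomposing with the retraction of the line onto [[0, b]] turns [phi] into a
    function that is nondecreasing everywhere. *)
Lemma measurable_nondecreasing_on (R : realType) (b : R) (phi : R -> R) :
  0 <= b -> nondecreasing_on 0 b phi -> measurable_fun (`[0, b] : set R) phi.
Proof.
move=> b0 hphi.
pose clamp y := Num.max 0 (Num.min b y).
have clampP y : 0 <= clamp y <= b.
  by rewrite /clamp le_max lexx/= ge_max b0 ge_min lexx.
apply: (@eq_measurable_fun _ _ _ _ _ (phi \o clamp)).
  move=> y; rewrite inE/= in_itv/= => /andP[y0 yb].
  by rewrite /clamp min_r// max_r.
apply: nondecreasing_measurable => // x y xy /=.
apply: hphi; rewrite ?in_itv/= ?clampP//.
by rewrite /clamp le_max2// le_min2.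
Qed.

Lemma measurable_nondecreasing_comp (R : realType) (b : R) (phi g : R -> R)
    (A : set R) :
    measurable A -> 0 <= b -> nondecreasing_on 0 b phi ->
    measurable_fun A g -> (forall x, A x -> 0 <= g x <= b) ->
  measurable_fun A (phi \o g).
Proof.
move=> mA b0 hphi mg gb.
apply: (@measurable_comp _ _ _ _ _ _ (`[0, b] : set R)) => //.
- by move=> _ [x Ax <-]/=; rewrite in_itv/=; exact: gb.
- exact: measurable_nondecreasing_on.
Qed.

(** Stochastic domination: each superlevel set of [phi \o g] lies in a set
    [t <= g], and the corresponding one of [phi \o h] contains [t < h], so the
    comparison of level sets passes to the integrals by the layer cake formula.
    The weak and strict inequalities in the hypothesis are what makes the value of
    [phi] at its jumps irrelevant. *)
Lemma le_integral_nondecreasing (R : realType) (A B : set R) (g h : R -> R)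
    (b c : R) (phi : R -> R) :
    let mu := @lebesgue_measure R in
    measurable A -> measurable B -> measurable_fun A g -> measurable_fun B h ->
    0 <= b -> 0 <= c ->
    (forall x, A x -> 0 <= g x <= b) -> (forall x, B x -> 0 <= h x <= b) ->
    nondecreasing_on 0 b phi -> (forall y, 0 <= y <= b -> 0 <= phi y) ->
    (forall t, 0 <= t <= b ->
      (mu (A `&` [set x | t <= g x])%R <=
       c%:E * mu (B `&` [set x | t < h x])%R)%E) ->
  (\int[mu]_(x in A) (phi (g x))%:E <=
    c%:E * \int[mu]_(x in B) (phi (h x))%:E)%E.
Proof.
move=> mu mA mB mg mh b0 c0 gb hb phi_nd phi0 dom.
have mpg := measurable_nondecreasing_comp mA b0 phi_nd mg gb.
have mph := measurable_nondecreasing_comp mB b0 phi_nd mh hb.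
have [|mL1 ->] := integral_superlevel mA mpg; first by move=> x /gb; exact: phi0.
have [|mL2 ->] := integral_superlevel mB mph; first by move=> x /hb; exact: phi0.
rewrite -ge0_integralZl//.
apply: ge0_le_integral => //.
- exact: emeasurable_funM.
- move=> s _.
  have [s0|s0] := ltP s 0.
    rewrite (_ : _ `&` _ = set0) ?measure0 ?mule_ge0//.
    by apply/seteqP; split => // x [_].
  have [t t0b tP] := upper_threshold s b0 phi_nd.
  apply: (le_trans _ (le_trans (dom t t0b) _)).
    apply: le_measure; rewrite ?inE; [|exact: measurable_level_ge|].
      exact: (@measurable_level_gt R _ (phi \o g)).
    by move=> x [Ax /= sx]; split => //=; apply: (tP _ (gb _ Ax)).1.
  apply: lee_wpmul2l; first by rewrite lee_fin.
  apply: le_measure; rewrite ?inE; [exact: measurable_level_gt| |].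
    exact: (@measurable_level_gt R _ (phi \o h)).
  by move=> x [Bx /= tx]; split => //=; apply: (tP _ (hb _ Bx)).2.
Qed.

(** * Primitives of bounded functions *)

Lemma ae_imply (R : realType) (P Q : R -> Prop) : (forall x, P x -> Q x) ->
  {ae @lebesgue_measure R, forall x, P x} ->
  {ae @lebesgue_measure R, forall x, Q x}.
Proof.
move=> PQ; apply: filterS => //.
exact: (ae_filter_ringOfSetsType (@lebesgue_measure R)).
Qed.

Lemma ae_imply2 (R : realType) (P Q S : R -> Prop) :
  (forall x, P x -> Q x -> S x) ->
  {ae @lebesgue_measure R, forall x, P x} ->
  {ae @lebesgue_measure R, forall x, Q x} ->
  {ae @lebesgue_measure R, forall x, S x}.
Proof.
move=> PQS; apply: filterS2 => //.
exact: (ae_filter_ringOfSetsType (@lebesgue_measure R)).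
Qed.

Definition bounded_between (R : realType) (m M : R) (g : R -> R) : Prop :=
  measurable_fun (`[0, 1] : set R) g /\ forall x, 0 <= x <= 1 -> m <= g x <= M.

Lemma bounded_betweenN (R : realType) (m M : R) (g : R -> R) :
  bounded_between m M g -> bounded_between (- M) (- m) (fun x => - g x).
Proof.
move=> [mg gb]; split; first exact: measurable_funN.
by move=> x /gb; rewrite !lerN2 andbC.
Qed.

Lemma bounded_between_integrable (R : realType) (m M : R) (g : R -> R)
    (i : interval R) :
  bounded_between m M g -> [set` i] `<=` `[0, 1] ->
  (@lebesgue_measure R).-integrable [set` i] (EFin \o g).
Proof.
move=> [mg gb] i01.
apply: (@integrableS _ _ R (@lebesgue_measure R) `[0, 1]) => //.
apply: measurable_bounded_integrable => //=.
  by rewrite lebesgue_measure_itv/= lte01 ltry.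
exists (Num.max `|m| `|M|); split; first exact: num_real.
move=> r rlt x /=; rewrite in_itv/= => /gb /andP[mx xM].
apply: ltW; apply: (le_lt_trans _ rlt); rewrite ler_norml; apply/andP; split.
  rewrite lerNl le_max; apply/orP; left.
  by rewrite -(normrN m); apply: le_trans (ler_norm _); rewrite lerN2.
by rewrite le_max; apply/orP; right; apply: (le_trans xM); exact: ler_norm.
Qed.

(** Clamping [f] to [[m, M]] makes its bounds hold everywhere and changes it on a
    null set only. *)
Lemma FmM_representative (R : realType) (m M : R) (f : R -> R) :
  m <= M -> FmM m M f -> exists2 g, bounded_between m M g & ae_eq01 f g.
Proof.
move=> mM [[mf _] fb _]; exists (fun x => Num.max m (Num.min M (f x))).
  split.
    by apply: measurable_maxr => //; apply: measurable_minr.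
  by move=> x _; rewrite le_max lexx/= ge_max mM ge_min lexx.
move: fb; apply: ae_imply => x fb x01; have /andP[mf' fM] := fb x01.
by rewrite min_r// max_r.
Qed.

Lemma J_ae (R : realType) (f g : R -> R) (x : R) :
  measurable_fun (`[0, 1] : set R) f -> measurable_fun (`[0, 1] : set R) g ->
  ae_eq01 f g -> x <= 1 -> J f x = J g x.
Proof.
move=> mf mg fg x1; rewrite /J /Rintegral; congr fine.
have sub : `[0, x] `<=` (`[0, 1] : set R).
  by move=> y /=; rewrite !in_itv/= => /andP[-> yx]; rewrite (le_trans yx).
apply: ae_eq_integral => //.
- by apply/measurable_EFinP; exact: measurable_funS mf.
- by apply/measurable_EFinP; exact: measurable_funS mg.
- by move: fg; apply: ae_imply => y fg /sub y01; rewrite /= fg.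
Qed.

Lemma J0 (R : realType) (f : R -> R) : J f 0 = 0.
Proof. by rewrite /J set_itv1 Rintegral_set1. Qed.

Lemma JN (R : realType) (m M x : R) (g : R -> R) :
  bounded_between m M g -> x <= 1 -> J (fun y => - g y) x = - J g x.
Proof.
move=> gb x1; rewrite /J -mulN1r -RintegralZl//.
  by apply: eq_Rintegral => y _; rewrite mulN1r.
apply: (bounded_between_integrable gb) => y /=; rewrite !in_itv/=.
by move=> /andP[-> /le_trans]; exact.
Qed.

Lemma itvoo_sub01 (R : realType) (x y : R) :
  0 <= x -> y <= 1 -> `]x, y[ `<=` (`[0, 1] : set R).
Proof.
move=> x0 y1 z /=; rewrite !in_itv/= => /andP[xz zy].
by rewrite (le_trans x0 (ltW xz)) (le_trans (ltW zy)).
Qed.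

Lemma J_sub (R : realType) (m M x y : R) (g : R -> R) :
    bounded_between m M g -> 0 <= x -> x <= y -> y <= 1 ->
  J g y - J g x = \int[@lebesgue_measure R]_(t in `]x, y[) g t.
Proof.
move=> gb x0 xy y1.
have sub : `]x, y[ `<=` (`[0, 1] : set R) by exact: itvoo_sub01.
have ig : (@lebesgue_measure R).-integrable `[0, y] (EFin \o g).
  apply: (bounded_between_integrable gb) => z /=; rewrite !in_itv/=.
  by move=> /andP[-> /le_trans]; exact.
rewrite /J (Rintegral_itvB ig) ?bnd_simp//.
by rewrite Rintegral_itv_bndo_bndc//; exact: (bounded_between_integrable gb).
Qed.

(** The bounds are required only on the open interval because the values of [f0]
    at its jump must not matter. *)
Lemma J_increment (R : realType) (m M lo hi x y : R) (g : R -> R) :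
    bounded_between m M g -> 0 <= x -> x <= y -> y <= 1 ->
    (forall t, x < t < y -> lo <= g t <= hi) ->
  lo * (y - x) <= J g y - J g x <= hi * (y - x).
Proof.
move=> gb x0 xy y1 lohi; rewrite (J_sub gb)//.
have len := fine_measure_itvoo xy.
have sub : `]x, y[ `<=` (`[0, 1] : set R) by exact: itvoo_sub01.
have ig := bounded_between_integrable gb sub.
have ic (c : R) : (@lebesgue_measure R).-integrable `]x, y[ (EFin \o cst c).
  apply: (@bounded_between_integrable R c c (cst c)) => //.
  by split => // z _; rewrite lexx.
rewrite -len -!Rintegral_cst//; apply/andP; split.
  apply: (le_Rintegral _ (ic lo) ig) => // t /=.
  by rewrite in_itv/= => /lohi/andP[].
apply: (le_Rintegral _ ig (ic hi)) => // t /=.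
by rewrite in_itv/= => /lohi/andP[].
Qed.

Lemma J_slopes (R : realType) (m M : R) (g : R -> R) :
  bounded_between m M g -> slopes_within m M (J g).
Proof.
move=> gb x y x0 xy y1; apply: (J_increment gb) => // t /andP[xt ty].
by apply: gb.2; rewrite (le_trans x0 (ltW xt)) (le_trans (ltW ty)).
Qed.

Lemma J_continuous (R : realType) (m M : R) (g : R -> R) :
  bounded_between m M g -> {within `[0, 1], continuous (J g)}.
Proof.
move=> gb; apply: (@parameterized_integral_continuous R 0 1 g) => //.
exact: (bounded_between_integrable gb).
Qed.

Lemma J_measurable (R : realType) (m M : R) (g : R -> R) :
  bounded_between m M g -> measurable_fun (`[0, 1] : set R) (J g).
Proof.
move=> gb; apply: subspace_continuous_measurable_fun => //.
exact: J_continuous gb.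
Qed.

(** If the increment is maximal, the nonnegative function [M - g] has integral
    zero, hence vanishes almost everywhere. *)
Lemma J_max_slope (R : realType) (m M x y : R) (g : R -> R) :
    bounded_between m M g -> 0 <= x -> x <= y -> y <= 1 ->
    J g y - J g x = M * (y - x) ->
  {ae @lebesgue_measure R, forall t, x < t < y -> g t = M}.
Proof.
move=> gb x0 xy y1; rewrite (J_sub gb)// => gM.
have sub : `]x, y[ `<=` (`[0, 1] : set R) by exact: itvoo_sub01.
have len := fine_measure_itvoo xy.
have ig := bounded_between_integrable gb sub.
have ic : (@lebesgue_measure R).-integrable `]x, y[ (EFin \o cst M).
  apply: (@bounded_between_integrable R M M (cst M)) => //.
  by split => // z _; rewrite lexx.
have zero : \int[@lebesgue_measure R]_(t in `]x, y[) (M - g t) = 0.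
  by rewrite RintegralB// Rintegral_cst// len gM subrr.
have mh : measurable_fun (`]x, y[ : set R) (fun t => M - g t).
  by apply: measurable_funB => //; apply: measurable_funS gb.1.
have h0 t : t \in `]x, y[ -> 0 <= M - g t.
  by move=> /sub /= /[!in_itv]/= /gb.2 /andP[_]; rewrite subr_ge0.
have : ae_eq (@lebesgue_measure R) (`]x, y[%classic : set R)
    (EFin \o (fun t => M - g t)) (cst 0%E).
  apply/ae_eq_integral_abs => //; first exact/measurable_EFinP.
  (* the integrand is nonnegative, so its absolute value can be dropped *)
  rewrite (_ : (\int[_]_(_ in _) _)%E =
      (\int[@lebesgue_measure R]_(t in `]x, y[) (M - g t)%:E)%E).
    rewrite -[LHS]fineK; first by rewrite -/(Rintegral _ _ _) zero.
    apply: integrable_fin_num => //.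
    exact: (@integrableB _ _ _ (@lebesgue_measure R) _ _ _ _ ic ig).
  by apply: eq_integral => t /set_mem /= /h0 ht; rewrite /= ger0_norm.
apply: ae_imply => t ht txy; have := ht txy => /= -[] /eqP.
by rewrite subr_eq0 => /eqP.
Qed.

(** * The inequality *)

Lemma integrable_nondecreasing_comp (R : realType) (b x y : R)
    (phi g : R -> R) :
    0 <= b -> nondecreasing_on 0 b phi ->
    measurable_fun (`[x, y] : set R) g ->
    (forall z, x <= z <= y -> 0 <= g z <= b) ->
  (@lebesgue_measure R).-integrable `[x, y] (EFin \o (phi \o g)).
Proof.
move=> b0 phi_nd mg gb.
apply: measurable_bounded_integrable => //=.
- rewrite lebesgue_measure_itv/= lte_fin; case: ifPn => // _.
  by rewrite -EFinB ltry.
- exact: (measurable_nondecreasing_comp _ b0).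
exists (Num.max `|phi 0| `|phi b|); split; first exact: num_real.
move=> r rlt z /=; rewrite in_itv/= => /gb /andP[gz0 gzb].
apply: ltW; apply: (le_lt_trans _ rlt); rewrite ler_norml; apply/andP; split.
  rewrite lerNl le_max; apply/orP; left.
  rewrite -(normrN (phi 0)); apply: le_trans (ler_norm _); rewrite lerN2.
  by apply: phi_nd; rewrite ?in_itv/= ?lexx ?gz0.
rewrite le_max; apply/orP; right; apply: (le_trans _ (ler_norm _)).
by apply: phi_nd; rewrite ?in_itv/= ?lexx ?gz0 ?b0.
Qed.

(** The four slope conditions relative to the endpoints give [F x <= M * x] and
    [F x <= - m * (1 - x)], together with the symmetric lower bounds; these lines
    meet at height [Tmax m M]. *)
Lemma slopes_le_Tmax (R : realType) (m M x : R) (F : R -> R) :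
    m < 0 -> 0 < M -> slopes_within m M F -> F 0 = 0 -> F 1 = 0 ->
  0 <= x <= 1 -> `|F x| <= Tmax m M.
Proof.
move=> m0 M0 sF F0 F1 /andP[x0 x1].
have Mm : 0 < M - m by lra.
have := sF 0 x (lexx _) x0 x1; have := sF x 1 x0 x1 (lexx _).
rewrite F0 F1 => /andP[a1 a2] /andP[a3 a4].
rewrite ler_norml; apply/andP; split.
  by rewrite lerNl ler_pdivlMr//; nra.
by rewrite ler_pdivlMr//; nra.
Qed.

(** The two lines that bound [F] from above reach the height [Tmax m M] at this
    abscissa only. *)
Lemma slopes_eq_Tmax (R : realType) (m M x : R) (F : R -> R) :
    m < 0 -> 0 < M -> slopes_within m M F -> F 0 = 0 -> F 1 = 0 ->
  0 <= x <= 1 -> F x = Tmax m M -> x = - m / (M - m).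
Proof.
move=> m0 M0 sF F0 F1 /andP[x0 x1] Fx.
have Mm : 0 < M - m by lra.
have := sF 0 x (lexx _) x0 x1; have := sF x 1 x0 x1 (lexx _).
have TE : Tmax m M = M * (- m / (M - m)) by rewrite /Tmax; ring.
have TE' : Tmax m M = - m * (1 - (- m / (M - m))).
  by rewrite /Tmax; field; rewrite gt_eqF.
rewrite F0 F1 Fx => /andP[a1 a2] /andP[a3 a4].
apply/le_anti/andP; split.
  rewrite TE' in a1.
  by rewrite -(ler_nM2l m0); lra.
by rewrite TE in a4; rewrite -(ler_pM2l M0); lra.
Qed.

(** The distribution of [`|F|] is dominated by the uniform distribution on
    [[0, Tmax m M]], by [measure_level_set_le]. *)
Lemma integral_abs_le_K (R : realType) (m M : R) (phi F : R -> R) :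
    let mu := @lebesgue_measure R in
    m < 0 -> 0 < M ->
    {in `[0, Tmax m M], forall x, 0 <= phi x} ->
    nondecreasing_on 0 (Tmax m M) phi ->
    measurable_fun (`[0, 1] : set R) F ->
    slopes_within m M F -> F 0 = 0 -> F 1 = 0 ->
  \int[mu]_(x in `[0, 1]) phi `|F x| <= K phi (Tmax m M).
Proof.
move=> mu m0 M0 phi0 phi_nd mF sF F0 F1.
have b0 := Tmax_gt0 m0 M0.
have mnF : measurable_fun (`[0, 1] : set R) (fun x => `|F x|).
  exact: measurableT_comp.
have nFb x : 0 <= x <= 1 -> 0 <= `|F x| <= Tmax m M.
  by move=> x01; rewrite normr_ge0/=; exact: slopes_le_Tmax sF F0 F1 x01.
have i1 := integrable_nondecreasing_comp (ltW b0) phi_nd mnF nFb.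
have i2 := integrable_nondecreasing_comp (ltW b0) phi_nd
  (@measurable_id _ _ (`[0, Tmax m M] : set R)) (fun _ => id).
rewrite /K -lee_fin EFinM /Rintegral !fineK; last 2 first.
- exact: integrable_fin_num i2.
- exact: integrable_fin_num i1.
apply: (@le_integral_nondecreasing R `[0, 1] `[0, Tmax m M] (fun x => `|F x|) id
  (Tmax m M)) => //.
- exact: ltW.
- by rewrite invr_ge0 ltW.
- move=> t t0b; apply: (le_trans (measure_level_set_le m0 M0 t0b mF sF F0 F1)).
  rewrite (_ : `[0, Tmax m M] `&` _ = `]t, Tmax m M]%classic); last first.
    apply/seteqP; split => x /=; rewrite !in_itv/=.
      by move=> [/andP[_ ->] ->].
    case/andP: t0b => t0 tb /andP[tx xb]; split => //.
    by rewrite xb (le_trans t0 (ltW tx)).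
  rewrite lebesgue_measure_itv/= lte_fin; case: ltP => [tb|bt].
    by rewrite -EFinB -EFinM lee_fin mulrBr mulVf ?gt_eqF// mulrC.
  by rewrite mule0 lee_fin subr_le0 ler_pdivlMr// mul1r.
Qed.

(** * The extremal functions *)

Lemma bounded_between_f0 (R : realType) (m M : R) :
  m < 0 -> 0 < M -> bounded_between m M (f0 m M).
Proof.
move=> m0 M0; split; last first.
  by move=> x _; rewrite /f0; case: ifP => _; rewrite lexx ?andbT/=; lra.
apply: measurable_funTS; apply: measurable_fun_ifT => //.
exact: measurable_fun_ltr.
Qed.

Lemma peak_itv (R : realType) (m M : R) : m < 0 -> 0 < M ->
  0 < - m / (M - m) < 1.
Proof.
move=> m0 M0; have Mm : 0 < M - m by lra.
by rewrite ltr_pdivlMr// ltr_pdivrMr//; apply/andP; split; lra.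
Qed.

Lemma J_f0 (R : realType) (m M : R) : m < 0 -> 0 < M ->
  (forall x, 0 <= x <= - m / (M - m) -> J (f0 m M) x = M * x) /\
  (forall x, - m / (M - m) <= x <= 1 -> J (f0 m M) x = m * (x - 1)).
Proof.
move=> m0 M0; have /andP[p0 p1] := peak_itv m0 M0.
have fb := bounded_between_f0 m0 M0.
have up x : 0 <= x <= - m / (M - m) -> J (f0 m M) x = M * x.
  move=> /andP[x0 xp].
  have slope t : 0 < t < x -> M <= f0 m M t <= M.
    by move=> /andP[_ tx]; rewrite /f0 (lt_le_trans tx xp) lexx.
  have /andP[] := J_increment fb (lexx 0) x0 (le_trans xp (ltW p1)) slope.
  by rewrite J0; lra.
split => // x /andP[px x1].
have pE : M * (- m / (M - m)) = m * (- m / (M - m) - 1).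
  by field; rewrite gt_eqF//; lra.
have slope t : - m / (M - m) < t < x -> m <= f0 m M t <= m.
  by move=> /andP[pt _]; rewrite /f0 ltNge (ltW pt) lexx.
have /andP[] := J_increment fb (ltW p0) px x1 slope.
have Jp : J (f0 m M) (- m / (M - m)) = m * (- m / (M - m) - 1).
  by rewrite up ?lexx ?(ltW p0).
rewrite Jp.
by move: (- m / (M - m)) => c; lra.
Qed.

(** For the tent [J f0] the level sets are the intervals [[t / M, 1 + t / m]],
    whose length attains the bound of [measure_level_set_le]; the domination then
    holds in the other direction as well. *)
Lemma K_le_integral_abs_J_f0 (R : realType) (m M : R) (phi : R -> R) :
    let mu := @lebesgue_measure R in
    m < 0 -> 0 < M ->
    {in `[0, Tmax m M], forall x, 0 <= phi x} ->
    nondecreasing_on 0 (Tmax m M) phi ->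
  K phi (Tmax m M) <= \int[mu]_(x in `[0, 1]) phi `|J (f0 m M) x|.
Proof.
move=> mu m0 M0 phi0 phi_nd.
have b0 := Tmax_gt0 m0 M0.
have fb := bounded_between_f0 m0 M0.
have [up down] := J_f0 m0 M0.
have /andP[p0 p1] := peak_itv m0 M0.
have J1 : J (f0 m M) 1 = 0 by rewrite down ?subrr ?mulr0// lexx ltW.
have mF := J_measurable fb.
set F := J (f0 m M).
have mnF : measurable_fun (`[0, 1] : set R) (fun x => `|F x|).
  exact: measurableT_comp.
have nFb x : 0 <= x <= 1 -> 0 <= `|F x| <= Tmax m M.
  move=> x01; rewrite normr_ge0/=.
  exact: slopes_le_Tmax (J_slopes fb) (J0 _) J1 x01.
have i1 := integrable_nondecreasing_comp (ltW b0) phi_nd mnF nFb.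
have i2 := integrable_nondecreasing_comp (ltW b0) phi_nd
  (@measurable_id _ _ (`[0, Tmax m M] : set R)) (fun _ => id).
(* the comparison is run backwards, with the constant [Tmax m M] on the right *)
rewrite /K mulrC ler_pdivrMr// mulrC -lee_fin EFinM /Rintegral !fineK;
    last 2 first.
- exact: integrable_fin_num i1.
- exact: integrable_fin_num i2.
apply: (@le_integral_nondecreasing R `[0, Tmax m M] `[0, 1] id (fun x => `|F x|)
  (Tmax m M)) => //.
- exact: ltW.
- exact: ltW.
move=> t /andP[t0 tb].
have tbV : t / M - t / m = t / Tmax m M by rewrite Tmax_inv// mulrBr.
apply: (@le_trans _ _ (Tmax m M - t)%:E).
  rewrite (_ : `[0, Tmax m M] `&` _ = `[t, Tmax m M]%classic); last first.
    apply/seteqP; split => x /=; rewrite !in_itv/=.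
      by move=> [/andP[_ ->] ->].
    move=> /andP[tx xb]; split => //.
    by rewrite xb (le_trans t0 tx).
  exact: measure_itvcc_le.
rewrite (_ : (Tmax m M - t)%:E =
    ((Tmax m M)%:E * (1 + t / m - t / M)%:E)%E); last first.
  rewrite -EFinM (_ : 1 + t / m - t / M = 1 - t / Tmax m M); last by lra.
  by rewrite mulrBr mulr1 mulrC divfK// gt_eqF.
apply: lee_wpmul2l; first by rewrite lee_fin ltW.
apply: (le_trans (measure_itvoo_ge _ _)).
apply: le_measure; rewrite ?inE//.
  exact: (@measurable_level_gt R `[0, 1] (fun x => `|F x|)).
move=> x /=; rewrite !in_itv/= => /andP[tx xt].
have tM : t < M * x by rewrite mulrC -ltr_pdivrMr.
have tm : t < m * (x - 1) by rewrite mulrC -ltr_ndivlMr//; lra.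
have x0 : 0 < x by apply: le_lt_trans tx; rewrite divr_ge0// ltW.
have x1 : x < 1 by rewrite -subr_lt0 -(nmulr_rgt0 _ m0); apply: le_lt_trans tm.
split; first by rewrite !ltW.
apply: (lt_le_trans _ (ler_norm _)).
have [xp|px] := leP x (- m / (M - m)); first by rewrite /F up// xp ltW.
by rewrite /F down// !ltW.
Qed.

Lemma f1E (R : realType) (m M x : R) : f1 m M x = - f0 (- M) (- m) x.
Proof. by rewrite /f1 /f0 !opprK (addrC (- m)); case: ifP; rewrite opprK. Qed.

Lemma integral_abs_J_eq_K (R : realType) (m M : R) (phi g : R -> R) :
    m < 0 -> 0 < M ->
    {in `[0, Tmax m M], forall x, 0 <= phi x} ->
    nondecreasing_on 0 (Tmax m M) phi ->
    bounded_between m M g -> ae_eq01 g (f0 m M) ->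
  \int[@lebesgue_measure R]_(x in `[0, 1]) phi `|J g x| = K phi (Tmax m M).
Proof.
move=> m0 M0 phi0 phi_nd gb gf0.
have fb := bounded_between_f0 m0 M0.
have JE x : x <= 1 -> J g x = J (f0 m M) x by exact: (J_ae gb.1 fb.1 gf0).
have [_ down] := J_f0 m0 M0.
have /andP[_ p1] := peak_itv m0 M0.
have J1 : J (f0 m M) 1 = 0 by rewrite down ?subrr ?mulr0// lexx ltW.
apply/le_anti/andP; split.
  apply: (integral_abs_le_K m0 M0 phi0 phi_nd (J_measurable gb)
    (J_slopes gb) (J0 _)).
  by rewrite JE.
apply: (le_trans (K_le_integral_abs_J_f0 m0 M0 phi0 phi_nd)).
rewrite le_eqVlt; apply/orP; left; apply/eqP/eq_Rintegral => x /set_mem/=.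
by rewrite in_itv/= => /andP[_ x1]; rewrite JE.
Qed.

(** * The case of equality *)

Lemma nondecreasing_on_minr (R : realType) (b c : R) (phi : R -> R) :
    0 <= c -> nondecreasing_on 0 b phi ->
  nondecreasing_on 0 b (fun y => phi (Num.min c y)).
Proof.
move=> c0 phi_nd x y; rewrite !in_itv/= => /andP[x0 xb] /andP[y0 yb] xy.
apply: phi_nd; rewrite ?in_itv/= ?le_min ?c0 ?x0 ?y0 ?ge_min ?xb ?yb ?orbT//.
by rewrite lexx xy orbT.
Qed.

(** Truncating the argument of [phi] at a height [c < b] loses mass, because [phi]
    exceeds [phi c] near [b]. *)
Lemma K_minr_lt (R : realType) (b c : R) (phi : R -> R) :
    0 <= c -> c < b -> nondecreasing_on 0 b phi -> ~ constant_on c b phi ->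
  K (fun y => phi (Num.min c y)) b < K phi b.
Proof.
move=> c0 cb phi_nd ncst.
have b0 : 0 < b by exact: le_lt_trans cb.
have mono x y : 0 <= x -> x <= y -> y <= b -> phi x <= phi y.
  move=> x0 xy yb; apply: phi_nd; rewrite ?in_itv/=.
  - by rewrite x0 (le_trans xy).
  - by rewrite (le_trans x0).
  - by [].
have [y /andP[cy yb] cyphi] : exists2 y, c < y < b & phi c < phi y.
  apply: contrapT => H; apply: ncst; exists (phi c) => x.
  rewrite in_itv/= => /andP[cx xb]; apply/le_anti/andP.
  split; last by apply: mono => //; exact: ltW.
  rewrite leNgt; apply/negP => h.
  by apply: H; exists x => //; rewrite cx.
have idb (z : R) : 0 <= z <= b -> 0 <= id z <= b by [].
have i1 := integrable_nondecreasing_comp (ltW b0) phi_nd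
  (@measurable_id _ _ (`[0, b] : set R)) idb.
have i2 := integrable_nondecreasing_comp (ltW b0)
  (nondecreasing_on_minr c0 phi_nd) (@measurable_id _ _ (`[0, b] : set R)) idb.
rewrite /K ltr_pM2l ?invr_gt0// -subr_gt0 -RintegralB//.
pose h x := phi x - phi (Num.min c x); rewrite -/h.
have ih : (@lebesgue_measure R).-integrable `[0, b] (EFin \o h).
  exact: (@integrableB _ _ _ (@lebesgue_measure R) _ _ _ _ i1 i2).
have h0 z : 0 <= z <= b -> 0 <= h z.
  move=> /andP[z0 zb]; rewrite /h subr_ge0; apply: mono => //.
    by rewrite le_min c0.
  by rewrite ge_min lexx orbT.
(* [h] is nonnegative, and at least [phi y - phi c > 0] beyond [y] *)
rewrite -[X in 0 < X](subrK (\int[@lebesgue_measure R]_(z in `[0, y]) h z)).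
have y0 : 0 <= y by rewrite (le_trans c0)// ltW.
rewrite ltr_pwDl//; last first.
  apply: Rintegral_ge0 => z /=; rewrite in_itv/= => /andP[z0 zy].
  by apply: h0; rewrite z0 (le_trans zy)// ltW.
rewrite (Rintegral_itvB ih) ?bnd_simp ?(ltW yb)//.
have len : fine (@lebesgue_measure R `]y, b]) = b - y.
  by rewrite lebesgue_measure_itv/= lte_fin yb.
apply: (@lt_le_trans _ _ ((phi y - phi c) * (b - y))).
  by rewrite mulr_gt0 ?subr_gt0.
rewrite -len -Rintegral_cst//; apply: le_Rintegral => //.
- apply: measurable_bounded_integrable => //=.
  + by rewrite lebesgue_measure_itv/= lte_fin yb -EFinB ltry.
  + exists `|phi y - phi c|; split; first exact: num_real.
    by move=> r /ltW + z _.
- apply: integrableS ih => // z /=; rewrite !in_itv/= => /andP[yz ->].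
  by rewrite (le_trans y0 (ltW yz)).
move=> z /=; rewrite in_itv/= => /andP[yz zb].
rewrite /h min_l; last by rewrite (le_trans (ltW cy))// ltW.
by rewrite lerB// mono// ltW.
Qed.

(** If the maximum [c] of [`|J g|] were below [Tmax m M], then truncating [phi] at
    [c] would leave the left-hand side unchanged, and the inequality for the
    truncated function would be strict for [phi] by [K_minr_lt]. *)
Lemma peak_of_equality (R : realType) (m M : R) (phi g : R -> R) :
    m < 0 -> 0 < M ->
    {in `[0, Tmax m M], forall x, 0 <= phi x} ->
    nondecreasing_on 0 (Tmax m M) phi ->
    nonconstant_up_to (Tmax m M) phi ->
    bounded_between m M g -> J g 1 = 0 ->
    \int[@lebesgue_measure R]_(x in `[0, 1]) phi `|J g x| = K phi (Tmax m M) ->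
  exists2 x, 0 <= x <= 1 & `|J g x| = Tmax m M.
Proof.
move=> m0 M0 phi0 phi_nd ncst gb J1 eqK.
have cJ : {within `[0, 1], continuous (fun x => `|J g x|)}.
  move=> x; apply: (@continuous_comp _ _ _ (J g : subspace `[0, 1] -> R)
    (@Num.norm _ R)).
    exact: J_continuous gb _.
  exact: norm_continuous.
have [x0 x01 maxx0] := EVT_max ler01 cJ.
have x0_01 : 0 <= x0 <= 1 by rewrite in_itv in x01.
exists x0 => //.
have cle : `|J g x0| <= Tmax m M.
  exact: slopes_le_Tmax (J_slopes gb) (J0 _) J1 x0_01.
apply/eqP; rewrite eq_le cle/= leNgt; apply/negP => clt.
set c := `|J g x0| in cle clt maxx0.
have c0 : 0 <= c by exact: normr_ge0.
have phic0 : {in `[0, Tmax m M], forall x, 0 <= phi (Num.min c x)}.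
  move=> x; rewrite in_itv/= => /andP[x0' xb].
  by apply: phi0; rewrite in_itv/= le_min c0 x0' ge_min xb orbT.
have := integral_abs_le_K m0 M0 phic0
  (nondecreasing_on_minr c0 phi_nd) (J_measurable gb) (J_slopes gb) (J0 _) J1.
rewrite (_ : \int[_]_(x in _) _ = K phi (Tmax m M)); last first.
  rewrite -eqK; apply: eq_Rintegral => x /set_mem/= x01'.
  by rewrite min_r//; exact: maxx0.
have := K_minr_lt c0 clt phi_nd (ncst c _); rewrite c0 clt => /(_ isT) lt.
by rewrite leNgt lt.
Qed.

Lemma ae_neq (R : realType) (a : R) :
  {ae @lebesgue_measure R, forall x, x <> a}.
Proof.
exists [set a]; split => //; first exact: lebesgue_measure_set1.
by move=> x /= /contrapT.
Qed.

(** The peak is at [- m / (M - m)], and reaching it forces the maximal slope [M]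
    before it; returning to [0] forces the minimal slope [m] after it, which is
    the maximal slope of [- g]. *)
Lemma ae_eq_f0_of_peak (R : realType) (m M x : R) (g : R -> R) :
    m < 0 -> 0 < M -> bounded_between m M g -> J g 1 = 0 ->
    0 <= x <= 1 -> J g x = Tmax m M ->
  ae_eq01 g (f0 m M).
Proof.
move=> m0 M0 gb J1 x01 Jx.
have xE := slopes_eq_Tmax m0 M0 (J_slopes gb) (J0 g) J1 x01 Jx.
have Mm : 0 < M - m by lra.
case/andP: x01 => x0 x1.
have up := @J_max_slope R m M 0 x g gb (lexx _) x0 x1.
have down := J_max_slope (bounded_betweenN gb) x0 x1 (lexx _).
have {}up : {ae @lebesgue_measure R, forall t, 0 < t < x -> g t = M}.
  by apply: up; rewrite J0 Jx xE /Tmax; field; rewrite gt_eqF.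
have {}down : {ae @lebesgue_measure R, forall t, x < t < 1 -> - g t = - m}.
  apply: down; rewrite !(JN gb)// J1 Jx xE /Tmax; field; rewrite gt_eqF//.
have ud := ae_imply2 (fun _ a b => conj a b) up down.
have n0x := ae_imply2 (fun _ a b => conj a b) (ae_neq 0) (ae_neq x).
apply: (ae_imply2 _ ud (ae_imply2 (fun _ a b => conj a b) n0x (ae_neq 1))).
move=> t [gM gm] [[/eqP t0 /eqP tx] /eqP t1].
rewrite in_itv/= => /andP[t0' t1'].
rewrite /f0 -xE; case: ltP => [ltx|lex].
  by apply: gM; rewrite lt_neqAle eq_sym t0 t0'.
by apply: oppr_inj; apply: gm; rewrite !lt_neqAle eq_sym tx lex t1 t1'.
Qed.

Theorem theorem2p3 (R : realType) (m M : R) (hm : m < 0) (hM : 0 < M)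
    (phi : R -> R)
    (phi_pos : {in `[0, Tmax m M], forall x, 0 <= phi x})
    (phi_incr : nondecreasing_on 0 (Tmax m M) phi) :
  [/\ forall f : R -> R, FmM m M f ->
        \int[@lebesgue_measure R]_(x in `[0, 1]) phi `|J f x|
          <= K phi (Tmax m M),
      ~ constant_on 0 (Tmax m M) phi ->
      forall f : R -> R, FmM m M f ->
        ae_eq01 f (f0 m M) \/ ae_eq01 f (f1 m M) ->
        \int[@lebesgue_measure R]_(x in `[0, 1]) phi `|J f x|
          = K phi (Tmax m M)
    & nonconstant_up_to (Tmax m M) phi ->
      forall f : R -> R, FmM m M f ->
        (\int[@lebesgue_measure R]_(x in `[0, 1]) phi `|J f x|
           = K phi (Tmax m M)
         <-> ae_eq01 f (f0 m M) \/ ae_eq01 f (f1 m M))].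
Proof.
have rep f : FmM m M f -> exists g, [/\ bounded_between m M g, ae_eq01 f g,
    J g 1 = 0 & \int[@lebesgue_measure R]_(x in `[0, 1]) phi `|J f x|
      = \int[@lebesgue_measure R]_(x in `[0, 1]) phi `|J g x|].
  move=> ff; have mM : m <= M by rewrite ltW// (lt_trans hm).
  have [g gb fg] := FmM_representative mM ff.
  have [[mf _] _ J1] := ff.
  have JE x : x <= 1 -> J f x = J g x by exact: (J_ae mf gb.1 fg).
  exists g; split => //; first by rewrite -JE.
  by apply: eq_Rintegral => x /set_mem/=; rewrite in_itv/= => /andP[_ /JE ->].
have hN : - M < 0 /\ 0 < - m by rewrite oppr_lt0 oppr_gt0.
have eq_case f : FmM m M f -> ae_eq01 f (f0 m M) \/ ae_eq01 f (f1 m M) ->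
    \int[@lebesgue_measure R]_(x in `[0, 1]) phi `|J f x| = K phi (Tmax m M).
  move=> /rep[g [gb fg J1 ->]] [ff0|ff1].
    apply: integral_abs_J_eq_K => //.
    by apply: ae_imply2 fg ff0 => x fg ff0 x01; rewrite -fg// ff0.
  have gN := bounded_betweenN gb.
  have aeN : ae_eq01 (fun x => - g x) (f0 (- M) (- m)).
    apply: ae_imply2 fg ff1 => x fg ff1 x01.
    by rewrite -fg// ff1// f1E opprK.
  rewrite -TmaxN -(integral_abs_J_eq_K hN.1 hN.2 _ _ gN aeN) ?TmaxN//.
  apply: eq_Rintegral => x /set_mem/=; rewrite in_itv/= => /andP[_ x1].
  by rewrite (JN gb)// normrN.
split.
- move=> f /rep[g [gb _ J1 ->]].
  exact: (integral_abs_le_K hm hM phi_pos phi_incr (J_measurable gb)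
    (J_slopes gb) (J0 _) J1).
- by move=> _; exact: eq_case.
move=> ncst f ff; split; last exact: eq_case.
have [g [gb fg J1 ->]] := rep f ff.
move=> /(peak_of_equality hm hM phi_pos phi_incr ncst gb J1)[x x01 Jx].
have [Jx0|Jx0] := leP 0 (J g x).
  rewrite ger0_norm// in Jx; left.
  apply: ae_imply2 fg (ae_eq_f0_of_peak hm hM gb J1 x01 Jx) => t fg gf t01.
  by rewrite fg// gf.
rewrite ltr0_norm// in Jx; right.
have x1 : x <= 1 by case/andP: x01.
have := @ae_eq_f0_of_peak _ _ _ x _ hN.1 hN.2 (bounded_betweenN gb).
rewrite !(JN gb)// J1 oppr0 TmaxN => /(_ erefl x01 Jx).
apply: ae_imply2 fg => t fg gf t01.
by rewrite fg// f1E -gf// opprK.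
Qed.
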